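(* Let $\star$ be a nucleus on a coherent near multiplicative lattice $Q$. (1) One has $x^{\star_w}=\bigvee\{x/z:\ z\in\star\text{-}\mathrm{GV}(Q)\cap\mathsf{K}(Q)\}$ for all $x\in Q$, and $\star_w$ is finitary. In particular, if $\star$ is finitary, then so is $\overline{\star}=\star_w$. (2) If every compact element of $Q$ is residuated and $x\wedge1$ exists for all $x\in Q$, then $\star_w$ is the coarsest stable finitary nucleus on $Q$ that is finer than $\star$.
   Context: A near multiplicative lattice is a commutative monoid $Q$ with a partial order compatible with multiplication such that every nonempty subset $X$ of $Q$ has a supremum and $a\bigvee X=\bigvee(aX)$ for all $a\in Q$. A directed subset of a poset is a nonempty subset in which every finite subset has an upper bound. An element $x$ is compact if whenever $x\le\bigvee\Delta$ for a directed $\Delta$ whose supremum exists, one has $x\le y$ for some $y\in\Delta$; $\mathsf{K}(Q)$ is the set of compact elements. $Q$ is precoherent if every element is a supremum of a set of compact elements and $\mathsf{K}(Q)$ is closed under multiplication; it is coherent if moreover $1\in\mathsf{K}(Q)$. For $x,y\in Q$, $x/y$ denotes the largest $z\in Q$ with $zy\le x$ (if it exists), and $y\backslash x$ the largest $z$ with $yz\le x$ (these coincide here by commutativity). An element $a$ is residuated if $x/a$ and $a\backslash x$ exist for all $x\in Q$. A closure operation is an expansive, order-preserving, idempotent self-map; a nucleus is a closure operation $\star$ with $x^\star y^\star\le(xy)^\star$ for all $x,y$ (where $x^\star=\star(x)$). A nucleus $\star$ is finitary if $(\bigvee\Delta)^\star=\bigvee\{x^\star:x\in\Delta\}$ for every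 directed $\Delta$ whose supremum exists. It is stable if $(\bigwedge X)^\star=\bigwedge\{x^\star:x\in X\}$ for every finite subset $X$ such that $\bigwedge X$ exists, and $(x/t)^\star=x^\star/t$ (resp., $(t\backslash x)^\star=t\backslash x^\star$) for all $x,t$ with $t$ compact such that $x/t$ (resp., $t\backslash x$) exists. For a nucleus $\star$ on $Q$: $\star\text{-}\mathrm{GV}(Q)=\{z\in Q: z\le1\text{ and }z^\star=1^\star\}$; $x^{\overline{\star}}=\bigvee\{x/z: z\in\star\text{-}\mathrm{GV}(Q)\}$ (where $x/z$ exists since $z\le1$); $\star_f$ is the nucleus $x^{\star_f}=\bigvee\{y^\star:y\in\mathsf{K}(Q), y\le x\}$; and $\star_w=\overline{\star_f}$. If $x^{\star_1}\le x^{\star_2}$ for all $x$, then $\star_1$ is finer than $\star_2$ and $\star_2$ is coarser than $\star_1$. *)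

(* Defs.v *)
From HB Require Import structures.
From mathcomp Require Import all_boot all_order.
From mathcomp Require Import boolp classical_sets functions cardinality.

Set Implicit Arguments.
Unset Strict Implicit.
Unset Printing Implicit Defensive.

Import Order.TTheory.

Local Open Scope classical_set_scope.
Local Open Scope group_scope.
Local Open Scope order_scope.

HB.mixin Record isNearMultLattice (d : Order.disp_t) Q
    of Order.POrder d Q & Monoid Q := {
  mulqC : forall x y : Q, x * y = y * x ;
  ler_mulq : forall a x y : Q, x <= y -> a * x <= a * y ;
  near_sup : forall X : set Q, X !=set0 -> supremums X !=set0 ;
  mulq_sup : forall (a : Q) (X : set Q) (s : Q), X !=set0 ->
    supremums X s -> supremums [set a * x | x in X] (a * s)
}.

#[short(type="nearMultLatticeType")]
HB.structure Definition NearMultLattice (d : Order.disp_t) :=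
  {Q of isNearMultLattice d Q & Order.POrder d Q & Monoid Q}.

Section NearMultLatticeDefs.
Context {d : Order.disp_t} {Q : nearMultLatticeType d}.
Implicit Types (x y z t : Q) (X D F : set Q) (star : Q -> Q).

(* The default value 1 is only returned for X = set0, see [qsupP]. *)
Definition qsup X : Q := supremum 1 X.

Definition directed D : Prop :=
  D !=set0 /\
  forall F, finite_set F -> F `<=` D -> exists2 u, D u & ubound F u.

Definition compact_elt x : Prop :=
  forall D s, directed D -> supremums D s -> x <= s ->
  exists2 y, D y & x <= y.

Definition is_largest X z : Prop := X z /\ ubound X z.

(* "x/y exists and equals z", resp. "y\x exists and equals z". *)
Definition is_rquot x y z : Prop := is_largest [set w | w * y <= x] z.
Definition is_lquot y x z : Prop := is_largest [set w | y * w <= x] z.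

(* x/y; the default value 1 is only returned when x/y does not exist. *)
Definition rquot x y : Q := xget 1 [set z | is_rquot x y z].

Definition residuated (a : Q) : Prop :=
  forall x, (exists z, is_rquot x a z) /\ (exists z, is_lquot a x z).

Definition closure_operation star : Prop :=
  [/\ forall x, x <= star x,
      forall x y, x <= y -> star x <= star y &
      forall x, star (star x) = star x].

Definition nucleus star : Prop :=
  closure_operation star /\ forall x y, star x * star y <= star (x * y).

Definition finitary star : Prop :=
  nucleus star /\
  forall D s, directed D -> supremums D s ->
    supremums [set star x | x in D] (star s).

(* An equality such as (x/t)^* = x^*/t includes the existence of its
   right-hand side. *)
Definition stable star : Prop :=
  [/\ nucleus star,
      forall X m, finite_set X -> infimums X m ->
        infimums [set star x | x in X] (star m),
      forall x t r, compact_elt t -> is_rquot x t r ->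
        is_rquot (star x) t (star r) &
      forall x t r, compact_elt t -> is_lquot t x r ->
        is_lquot t (star x) (star r)].

Definition finer star1 star2 : Prop := forall x, star1 x <= star2 x.

Definition GV star : set Q := [set z | z <= 1 /\ star z = star 1].

Definition star_bar star x : Q := qsup [set rquot x z | z in GV star].

(* When Q is precoherent the index set is nonempty: if x is the supremum of the
   empty set, then x is the bottom element and hence compact. *)
Definition star_f star x : Q :=
  qsup [set star y | y in [set y | compact_elt y /\ y <= x]].

Definition star_w star : Q -> Q := star_bar (star_f star).

Lemma qsupP X : X !=set0 -> supremums X (qsup X).
Proof.
move=> X0; rewrite /qsup /supremum; case: ifPn => [/eqP XE|_].
  by case: X0 => x; rewrite XE.
have [s Xs] := near_sup X X0.
by case: xgetP => [y _ //|/(_ s)].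
Qed.

Lemma rquotP x y z : is_rquot x y z -> rquot x y = z.
Proof.
move=> [xz ubz]; rewrite /rquot; case: xgetP => [w -> [xw ubw]|/(_ z) []//].
by apply/le_anti; rewrite ubz ?ubw.
Qed.

Lemma rquot_le1 x z : z <= 1 -> is_rquot x z (rquot x z).
Proof.
move=> z1; set A := [set w | w * z <= x].
have A0 : A !=set0.
  by exists x; rewrite /A /=; have := ler_mulq x _ _ z1; rewrite mulg1.
have [ubA lubA] := qsupP A0.
suff h : is_rquot x z (qsup A) by rewrite (rquotP h).
split=> //=; rewrite mulqC.
have [_ ] := mulq_sup z A _ A0 (qsupP A0); apply=> _ [w Aw <-].
by rewrite mulqC.
Qed.

End NearMultLatticeDefs.

Arguments qsup {d Q} X.

Definition compacts {d : Order.disp_t} (Q : nearMultLatticeType d) : set Q :=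
  [set x | compact_elt x].
Arguments compacts {d} Q _ : rename.

Section Coherence.
Context {d : Order.disp_t} (Q : nearMultLatticeType d).

Definition precoherent : Prop :=
  (forall x : Q, exists2 X : set Q, X `<=` compacts Q & supremums X x) /\
  (forall x y : Q, compacts Q x -> compacts Q y -> compacts Q (x * y)).

Definition coherent : Prop := precoherent /\ compacts Q 1.

End Coherence.

(* Main.v *)
(** The proof tests inequalities on compact elements.  Let [G] be the set of
    compact [z] in [GV star].  Since [1] is compact, every element of
    [GV (star_f star)] dominates an element of [G], so [star_w star x] is the
    directed supremum of the [x/z] with [z] in [G].  Hence, for compact [y],
    [y <= star_w star x] if and only if [y * z <= x] for some [z] in [G], and
    all properties of [star_w] follow because [G] is closed under products.  For
    maximality, if [y <= sigma x] with [y] compact, then stability gives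
    [1 <= sigma (x/y /\ 1)], and finitarity yields a compact
    [c <= x/y /\ 1] with [1 <= sigma c <= star c], that is, [c] in [G] with
    [y * c <= x]. *)
Require Import Defs.
From mathcomp Require Import all_boot all_order.
From mathcomp Require Import boolp classical_sets functions cardinality.

Set Implicit Arguments.
Unset Strict Implicit.
Unset Printing Implicit Defensive.

Import Order.TTheory.

Local Open Scope classical_set_scope.
Local Open Scope group_scope.
Local Open Scope order_scope.

(** Induction on an enumeration of [F], merging two witnesses at each step. It serves both to reduce
    directedness to pairs and to find one element of [G] that works for a whole finite set. *)
Lemma finite_common_witness (T : Type) (U : choiceType) (P : set T)
    (R : T -> set U) (F : set U) :
  P !=set0 ->
  (forall z w, P z -> P w -> exists2 v, P v & R z `|` R w `<=` R v) ->
  finite_set F -> (forall x, F x -> exists2 z, P z & R z x) ->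
  exists2 z, P z & F `<=` R z.
Proof.
move=> [z0 Pz0] PR /finite_seqP[s ->].
elim: s => [|a s IH] Fs; first by exists z0.
have [x sx|z Pz sz] := IH; first by apply: Fs; rewrite /= inE sx orbT.
have [|w Pw aw] := Fs a; first by rewrite /= inE eqxx.
have [v Pv zwv] := PR z w Pz Pw.
exists v => // x; rewrite /= inE => /orP[/eqP ->|xs]; apply: zwv.
  by right.
by left; apply: sz.
Qed.

(** * Quotients, directed sets and compact elements *)

Section NearMultLatticeTheory.
Context {d : Order.disp_t} {Q : nearMultLatticeType d}.
Implicit Types (a x y z t : Q) (X D : set Q) (star sigma : Q -> Q).

Lemma ler_mulqr a x y : x <= y -> x * a <= y * a.
Proof. by rewrite ![_ * a]mulqC; exact: ler_mulq. Qed.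

Lemma mulq_le1r a z : z <= 1 -> a * z <= a.
Proof. by move=> z1; rewrite -{2}[a]mulg1; exact: ler_mulq. Qed.

Lemma le_rquot a x z : z <= 1 -> (a <= rquot x z) <-> (a * z <= x).
Proof.
move=> z1; have [xz ub] := rquot_le1 x z1; split=> [az|]; last exact: ub.
exact: le_trans (ler_mulqr z az) xz.
Qed.

Lemma directed2 D x y : directed D -> D x -> D y ->
  exists2 u, D u & x <= u /\ y <= u.
Proof.
move=> [_ dirD] Dx Dy.
have [||u Du ubu] := dirD [set x; y]; first exact: finite_set2.
  by move=> _ [->|->].
by exists u => //; split; apply: ubu; [left|right].
Qed.

Lemma directedP D : D !=set0 ->
  (forall x y, D x -> D y -> exists2 u, D u & x <= u /\ y <= u) ->
  directed D.
Proof.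
move=> D0 D2; split=> // F finF FD.
apply: (@finite_common_witness _ _ D (fun u => [set x | x <= u]) F) => //.
  move=> z w Dz Dw; have [u Du [zu wu]] := D2 z w Dz Dw.
  by exists u => // x [/= /le_trans|/= /le_trans]; apply.
by move=> x Fx; exists x; [exact: FD|rewrite /=].
Qed.

Lemma directed_image (f : Q -> Q) D :
  {homo f : x y / x <= y} -> directed D -> directed [set f x | x in D].
Proof.
move=> f_homo dirD; apply: directedP.
  by have [[x Dx] _] := dirD; exists (f x), x.
move=> _ _ [x Dx <-] [y Dy <-].
have [u Du [xu yu]] := directed2 dirD Dx Dy.
by exists (f u); [exists u|split; apply: f_homo].
Qed.

Lemma compact_bottom x : (forall y, x <= y) -> compact_elt x.
Proof. by move=> x_min D s [[y Dy] _] _ _; exists y. Qed.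

Lemma compact_sup2 x y s : compact_elt x -> compact_elt y ->
  supremums [set x; y] s -> compact_elt s.
Proof.
move=> cx cy [ubs lubs] D b dirD Db sb.
have [|u Du xu] := cx D b dirD Db.
  by apply: le_trans sb; apply: ubs; left.
have [|v Dv yv] := cy D b dirD Db.
  by apply: le_trans sb; apply: ubs; right.
have [w Dw [uw vw]] := directed2 dirD Du Dv.
exists w => //; apply: lubs => _ [->|->].
  exact: le_trans xu uw.
exact: le_trans yv vw.
Qed.

Definition lower_compacts x : set Q := [set y | compact_elt y /\ y <= x].

Lemma lower_compacts_sup x : precoherent Q -> supremums (lower_compacts x) x.
Proof.
move=> [alg _]; have [X cX [ubx lubx]] := alg x.
split=> [y [_ //]|u ubu]; apply: lubx => y Xy.
by apply: ubu; split; [exact: cX|exact: ubx].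
Qed.

Lemma lower_compacts_neq0 x : precoherent Q -> lower_compacts x !=set0.
Proof.
move=> pQ; have [_ lubx] := lower_compacts_sup x pQ.
apply: contrapT => none; apply: (none); exists x; split=> //.
by apply: compact_bottom => y; apply: lubx => z xz; case: none; exists z.
Qed.

(** Binary joins always exist in [Q], and the join of two compact elements is compact. *)
Lemma lower_compacts_directed x : precoherent Q -> directed (lower_compacts x).
Proof.
move=> pQ; apply: directedP; first exact: lower_compacts_neq0.
move=> y z [cy yx] [cz zx].
have [|s ss] := near_sup [set y; z]; first by exists y; left.
exists s; first split; first exact: compact_sup2 ss.
  by case: ss => _; apply=> _ [->|->].
by case: ss => ub _; split; apply: ub; [left|right].
Qed.

Lemma compact_le x u : precoherent Q ->
  (forall y, compact_elt y -> y <= x -> y <= u) -> x <= u.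
Proof.
by move=> pQ h; have [_] := lower_compacts_sup x pQ; apply=> y [? ?]; exact: h.
Qed.

(** * Nuclei and their [GV] sets *)

Lemma nucleus_ge star x : nucleus star -> x <= star x.
Proof. by move=> [[]]. Qed.

Lemma nucleus_homo star : nucleus star -> {homo star : x y / x <= y}.
Proof. by move=> [[]]. Qed.

Lemma GV_ge1 star z : nucleus star -> z <= 1 -> 1 <= star z -> GV star z.
Proof.
move=> nstar z1 sz; split=> //; apply/le_anti.
rewrite (nucleus_homo nstar z1) /=.
by case: nstar => [[_ homo idem] _]; rewrite -[leRHS]idem; exact: homo.
Qed.

(** The chain is [a <= star a * star 1 = star a * star z <= star (a * z) <= star x]. *)
Lemma GV_le_star star a x z : nucleus star -> GV star z -> a * z <= x ->
  a <= star x.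
Proof.
move=> nstar [z1 sz] azx; have [_ starM] := nstar.
apply: le_trans (nucleus_homo nstar azx).
apply: le_trans (starM a z); rewrite sz.
have := ler_mulq (star a) _ _ (nucleus_ge 1 nstar); rewrite mulg1.
exact: le_trans (nucleus_ge a nstar).
Qed.

Lemma GV1 star : GV star 1. Proof. by []. Qed.

Lemma GVM star z w : nucleus star -> GV star z -> GV star w -> GV star (z * w).
Proof.
move=> nstar Gz Gw; have [z1 _] := Gz; have [w1 _] := Gw.
apply: GV_ge1 => //; first exact: le_trans (mulq_le1r z w1) z1.
(* [GV_le_star] is used twice: [w] gives [z <= star (z * w)], then [z] gives
   [1 <= star (star (z * w))]. *)
have [[_ _ idem] _] := nstar; rewrite -idem.
by apply: (GV_le_star nstar Gz); rewrite mul1g; exact: GV_le_star Gw _.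
Qed.

(** Keeping [s] abstract covers both [s = star_f star x] and, for finitary [star], [s = star x]. *)
Lemma compact_le_star star x s y : precoherent Q -> nucleus star ->
  supremums [set star c | c in lower_compacts x] s ->
  compact_elt y -> y <= s -> exists2 c, lower_compacts x c & y <= star c.
Proof.
move=> pQ nstar sup_star cy ys.
have dirx := directed_image (nucleus_homo nstar) (lower_compacts_directed x pQ).
by have [_ [c xc <-] yc] := cy _ _ dirx sup_star ys; exists c.
Qed.

(** * The finitary part [star_f] and the formula for [star_w] *)

Lemma star_f_sup star x : precoherent Q ->
  supremums [set star y | y in lower_compacts x] (star_f star x).
Proof.
move=> pQ; apply: qsupP.
by have [c xc] := lower_compacts_neq0 x pQ; exists (star c), c.
Qed.

Lemma star_f_compact star y : precoherent Q -> nucleus star ->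
  compact_elt y -> star_f star y = star y.
Proof.
move=> pQ nstar cy; apply: is_subset1_supremums (star_f_sup star y pQ) _.
split=> [_ [x [_ xy] <-]|u]; first exact: nucleus_homo.
by apply; exists y.
Qed.

Lemma star_f_finitary star : precoherent Q -> finitary star ->
  star_f star = star.
Proof.
move=> pQ [nstar fstar]; apply/funext => x.
have sup_star := fstar _ _ (lower_compacts_directed x pQ)
  (lower_compacts_sup x pQ).
exact: is_subset1_supremums (star_f_sup star x pQ) sup_star.
Qed.

(** Since [1 <= star_f star z] and [1] is compact, a single compact [c <= z] already satisfies
    [1 <= star c]. *)
Lemma GV_star_f star z : coherent Q -> nucleus star -> GV (star_f star) z ->
  exists2 c, (GV star `&` compacts Q) c & c <= z.
Proof.
move=> [pQ c1] nstar [z1 sz].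
have [|c [cc cz] c_ge1] := compact_le_star pQ nstar (star_f_sup star z pQ) c1.
  by rewrite sz star_f_compact //; exact: nucleus_ge.
exists c => //; split=> //; apply: GV_ge1 => //; exact: le_trans z1.
Qed.

Lemma GV_compact_star_f star : coherent Q -> nucleus star ->
  GV star `&` compacts Q `<=` GV (star_f star).
Proof.
by move=> [pQ c1] nstar z [[z1 sz] cz]; split=> //; rewrite !star_f_compact.
Qed.

Lemma star_wE star x : coherent Q -> nucleus star ->
  star_w star x = qsup [set rquot x z | z in GV star `&` compacts Q].
Proof.
move=> cohQ nstar; have [_ c1] := cohQ.
have G1 : (GV star `&` compacts Q) 1 by split; first exact: GV1.
have ne1 : [set rquot x z | z in GV (star_f star)] !=set0.
  by exists (rquot x 1), 1 => //; exact: GV1.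
have ne2 : [set rquot x z | z in GV star `&` compacts Q] !=set0.
  by exists (rquot x 1), 1.
apply: (is_subset1_supremums (qsupP ne1)); have [ub lub] := qsupP ne2.
split=> [_ [z Gz <-]|u ubu].
  (* Shrinking [z] to a compact [c] only enlarges the quotient: [x/z <= x/c]. *)
  have [c Gc cz] := GV_star_f cohQ nstar Gz; have [z1 _] := Gz.
  apply: le_trans (ub (rquot x c) _); last by exists c.
  have [[c1' _] _] := Gc; apply/(le_rquot _ _ c1').
  apply: le_trans (ler_mulq _ _ _ cz) _; exact/(le_rquot _ _ z1).
apply: lub => _ [z Gz <-]; apply: ubu; exists z => //.
exact: GV_compact_star_f Gz.
Qed.

(** * Properties of [star_w] via compact [GV] elements *)

Section StarW.
Context (star : Q -> Q) (cohQ : coherent Q) (nstar : nucleus star).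
Let pQ : precoherent Q := cohQ.1.
Let G := GV star `&` compacts Q.

Let G1 : G 1. Proof. by split; [exact: GV1|exact: cohQ.2]. Qed.

Let GM z w : G z -> G w -> G (z * w).
Proof.
move=> [Gz cz] [Gw cw]; split; first exact: GVM.
by case: pQ => _; apply.
Qed.

Let G_le1 z : G z -> z <= 1. Proof. by move=> [[]]. Qed.

Let rquots_directed x : directed [set rquot x z | z in G].
Proof.
apply: directedP; first by exists (rquot x 1), 1.
move=> _ _ [z Gz <-] [w Gw <-].
(* Both [x/z] and [x/w] lie below [x/(z * w)], because [z] and [w] are at most [1]. *)
have zw := GM Gz Gw.
exists (rquot x (z * w)); first by exists (z * w).
split; apply/(le_rquot _ _ (G_le1 zw)).
  rewrite mulgA; apply: le_trans (mulq_le1r _ (G_le1 Gw)) _.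
  exact/(le_rquot _ _ (G_le1 Gz)).
rewrite (mulqC z) mulgA; apply: le_trans (mulq_le1r _ (G_le1 Gz)) _.
exact/(le_rquot _ _ (G_le1 Gw)).
Qed.

Lemma star_w_sup x : supremums [set rquot x z | z in G] (star_w star x).
Proof. by rewrite star_wE //; apply: qsupP; case: (rquots_directed x). Qed.

Lemma le_star_w a x z : G z -> a * z <= x -> a <= star_w star x.
Proof.
move=> Gz azx; have [ub _] := star_w_sup x.
apply: le_trans (ub (rquot x z) _); last by exists z.
exact/(le_rquot _ _ (G_le1 Gz)).
Qed.

Lemma compact_le_star_w x y : compact_elt y -> y <= star_w star x ->
  exists2 z, G z & y * z <= x.
Proof.
move=> cy yx.
have [_ [z Gz <-] yz] := cy _ _ (rquots_directed x) (star_w_sup x) yx.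
by exists z => //; apply/(le_rquot _ _ (G_le1 Gz)).
Qed.

Lemma star_w_nucleus : nucleus (star_w star).
Proof.
have ge x : x <= star_w star x by apply: (le_star_w G1); rewrite mulg1.
have homo x y : x <= y -> star_w star x <= star_w star y.
  move=> xy; apply: (compact_le pQ) => c cc /(compact_le_star_w cc)[z Gz czx].
  exact: le_star_w Gz (le_trans czx xy).
split; first split=> //.
- move=> x; apply/le_anti; rewrite ge andbT; apply: (compact_le pQ) => c cc.
  move=> /(compact_le_star_w cc)[z Gz cz].
  (* The product [c * z] is again compact, so the criterion applies a second time; [z * w] then
     witnesses [c <= star_w star x]. *)
  have [|w Gw czw] := compact_le_star_w _ cz.
    by case: pQ => _; apply=> //; case: Gz.
  by apply: (le_star_w (GM Gz Gw)); rewrite mulgA.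
(* Distributing the product over both suprema leaves [(y/w) * (x/z) <= star_w star (x * y)],
   witnessed by [z * w]. *)
- move=> x y; have := mulq_sup (star_w star x) _ _ (rquots_directed y).1
    (star_w_sup y).
  move=> [_]; apply=> _ [_ [w Gw <-] <-]; rewrite mulqC.
  have := mulq_sup (rquot y w) _ _ (rquots_directed x).1 (star_w_sup x).
  move=> [_]; apply=> _ [_ [z Gz <-] <-].
  apply: (le_star_w (GM Gz Gw)).
  have xz : rquot x z * z <= x by apply/(le_rquot _ _ (G_le1 Gz)).
  have yw : rquot y w * w <= y by apply/(le_rquot _ _ (G_le1 Gw)).
  have -> : rquot y w * rquot x z * (z * w) = (rquot x z * z) * (rquot y w * w).
    by rewrite (mulqC (rquot y w)) -!mulgA; congr (_ * _);
      rewrite mulqC -mulgA; congr (_ * _); exact: mulqC.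
  exact: le_trans (ler_mulqr _ xz) (ler_mulq _ _ _ yw).
Qed.

Lemma star_w_finitary : finitary (star_w star).
Proof.
split; first exact: star_w_nucleus.
move=> D s dirD Ds; split=> [_ [x Dx <-]|u ubu].
  by apply: (nucleus_homo star_w_nucleus); case: Ds => ub _; exact: ub.
apply: (compact_le pQ) => y cy /(compact_le_star_w cy)[z Gz yzs].
(* Compactness of [y * z] moves the inequality from [s] to a member of [D], with the same witness
   [z]. *)
have cyz : compact_elt (y * z) by case: pQ => _; apply=> //; case: Gz.
have [x Dx yzx] := cyz _ _ dirD Ds yzs.
by apply: le_trans (le_star_w Gz yzx) _; apply: ubu; exists x.
Qed.

Lemma star_w_finer : finer (star_w star) star.
Proof.
move=> x; apply: (compact_le pQ) => y cy /(compact_le_star_w cy)[z [Gz _]].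
exact: GV_le_star.
Qed.

Let star_w_rquot x t r : compact_elt t -> is_rquot x t r ->
  is_rquot (star_w star x) t (star_w star r).
Proof.
move=> ct [rt ubr]; split=> /= [|w wt].
  have [_ starM] := star_w_nucleus.
  apply: le_trans (nucleus_homo star_w_nucleus rt).
  apply: le_trans (starM r t).
  exact: ler_mulq (nucleus_ge t star_w_nucleus).
apply: (compact_le pQ) => y cy yw.
(* As [t] is compact, so is [y * t]; from [y * t * z <= x] one gets [y * z <= r] by maximality of
   [r]. *)
have [||z Gz ytz] := @compact_le_star_w x (y * t).
- by case: pQ => _; apply.
- exact: le_trans (ler_mulqr t yw) wt.
apply: (le_star_w Gz); apply: ubr; rewrite /=.
by rewrite -mulgA (mulqC z) mulgA.
Qed.

Lemma star_w_stable : stable (star_w star).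
Proof.
split; [exact: star_w_nucleus| |exact: star_w_rquot|].
- move=> X m finX [lbm glbm]; split=> [_ [x Xx <-]|u lbu].
    by apply: (nucleus_homo star_w_nucleus); exact: lbm.
  apply: (compact_le pQ) => y cy yu.
  (* Each [x] in [X] has its own witness in [G]; products of these give one [z] valid for all of the
     finite set [X], even if [X] is empty. *)
  have [||x Xx|z Gz yz] :=
      @finite_common_witness _ _ G (fun z => [set x | y * z <= x]) X _ _ finX.
  + by exists 1.
  + move=> z w Gz Gw; exists (z * w); first exact: GM.
    move=> x [/=|/=]; apply: le_trans; apply: ler_mulq.
      exact: mulq_le1r (G_le1 Gw).
    by rewrite mulqC; exact: mulq_le1r (G_le1 Gz).
  + apply: compact_le_star_w => //; apply: le_trans yu _.
    by apply: lbu; exists x.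
  apply: (le_star_w Gz); apply: glbm => x Xx; exact: yz.
- move=> x t r ct.
  have E x' : [set w | t * w <= x'] = [set w | w * t <= x'].
    by apply/seteqP; split=> w /=; rewrite mulqC.
  rewrite /is_lquot !E; exact: star_w_rquot.
Qed.

Lemma star_w_coarsest sigma :
  (forall t, compacts Q t -> residuated t) ->
  (forall x, exists m, infimums [set x; 1] m) ->
  stable sigma -> finitary sigma -> finer sigma star ->
  finer sigma (star_w star).
Proof.
move=> res meet1 [nsig sig_inf sig_rquot _] [_ fsig] sig_star x.
apply: (compact_le pQ) => y cy yx.
have [[r ryx] _] := res y cy x.
have [m rm] := meet1 r.
(* By stability [sigma r] is the largest [w] with [w * y <= sigma x], and [w = 1] qualifies. *)
have r_ge1 : 1 <= sigma r.
  by have [_] := sig_rquot _ _ _ cy ryx; apply; rewrite /= mul1g.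
have m_ge1 : 1 <= sigma m.
  have [|_] := sig_inf _ _ _ rm; first exact: finite_set2.
  by apply=> _ [_ [->|->] <-] //; exact: nucleus_ge.
have sup_sig := fsig _ _ (lower_compacts_directed m pQ)
  (lower_compacts_sup m pQ).
have [c [cc cm] c_ge1] := compact_le_star pQ nsig sup_sig cohQ.2 m_ge1.
have [lbm _] := rm; have [ryx' _] := ryx.
apply: (@le_star_w _ _ c).
  split=> //; apply: GV_ge1 => //; last exact: le_trans c_ge1 (sig_star c).
  by apply: le_trans cm _; apply: lbm; right.
rewrite mulqC; apply: le_trans ryx'; apply: ler_mulqr.
by apply: le_trans cm _; apply: lbm; left.
Qed.

End StarW.
End NearMultLatticeTheory.

Theorem proposition11p4 (d : Order.disp_t) (Q : nearMultLatticeType d)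
  (star : Q -> Q) (Hcoh : coherent Q) (Hstar : nucleus star) :
  [/\ forall x : Q,
        star_w star x = qsup [set rquot x z | z in GV star `&` compacts Q],
      finitary (star_w star) &
      finitary star ->
        finitary (star_bar star) /\ star_bar star =1 star_w star]
  /\
  ((forall t : Q, compacts Q t -> residuated t) ->
   (forall x : Q, exists m : Q, infimums [set x; 1] m) ->
   [/\ stable (star_w star), finitary (star_w star), finer (star_w star) star &
       forall sigma : Q -> Q, stable sigma -> finitary sigma ->
         finer sigma star -> finer sigma (star_w star)]).
Proof.
have fw := star_w_finitary Hcoh Hstar.
split=> [|res meet1].
  split=> [x||fstar] //; first exact: star_wE.
  (* A finitary [star] equals [star_f star], so the two constructions coincide. *)
  have barE : star_bar star = star_w star.
    by rewrite /star_w (star_f_finitary Hcoh.1 fstar).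
  by rewrite barE.
split=> // [||sigma].
- exact: star_w_stable.
- exact: star_w_finer.
- exact: star_w_coarsest.
Qed.
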